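(* For every integer $k \geq 1$, $\mathrm{Dist}(\Omega_{2k}) > 2$.
   Context: The orthogonality graph $\Omega_{2k}$ has vertex set $\mathbb{Z}_2^{2k}$ (bitstrings of length $2k$), with two vertices adjacent if and only if their bitstrings differ in exactly $k$ positions. A labeling $f: V(G)\to\{1,\dots,d\}$ of a graph $G$ is $d$-distinguishing if the only automorphism of $G$ preserving every label class is the identity; $\mathrm{Dist}(G)$ is the least $d$ for which $G$ has a $d$-distinguishing labeling. *)

(* Defs.v *)
From mathcomp Require Import all_boot all_fingroup all_algebra.

Set Implicit Arguments.
Unset Strict Implicit.
Unset Printing Implicit Defensive.

(* A graph is a finite type T of vertices with an adjacency relation e : rel T. *)

Definition is_aut (T : finType) (e : rel T) (p : {perm T}) : bool :=
  [forall x, forall y, e (p x) (p y) == e x y].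

(* The labels {1, ..., d} are represented by 'I_d = {0, ..., d - 1}. *)
Definition preserves_classes (T : finType) (d : nat) (f : {ffun T -> 'I_d})
    (p : {perm T}) : bool :=
  [forall c : 'I_d, p @: (f @^-1: [set c]) == f @^-1: [set c]].

Definition distinguishing (T : finType) (e : rel T) (d : nat)
    (f : {ffun T -> 'I_d}) : bool :=
  [forall p : {perm T}, is_aut e p && preserves_classes f p ==> (p == 1%g)].

Definition has_distinguishing (T : finType) (e : rel T) (d : nat) : bool :=
  [exists f : {ffun T -> 'I_d}, distinguishing e f].

Lemma ex_distinguishing (T : finType) (e : rel T) :
  exists d, has_distinguishing e d.
Proof.
exists #|T|; apply/existsP; exists [ffun x => enum_rank x].
apply/forallP => p; apply/implyP => /andP[_ /forallP pres].
apply/eqP/permP => x; rewrite perm1.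
have: p x \in p @: ([ffun y => enum_rank y] @^-1: [set enum_rank x]).
  by apply: imset_f; rewrite !inE ffunE.
by rewrite (eqP (pres _)) !inE ffunE => /eqP/enum_rank_inj.
Qed.

Definition Dist (T : finType) (e : rel T) : nat :=
  ex_minn (ex_distinguishing e).

Local Open Scope ring_scope.

(* Adjacency of Omega_{2k}: Hamming distance exactly k. *)
Definition orthogonality (k : nat) : rel 'rV['F_2]_(2 * k) :=
  fun x y => #|[set i | x ord0 i != y ord0 i]| == k.

Lemma orthogonality_sym (k : nat) : symmetric (@orthogonality k).
Proof.
move=> x y; rewrite /orthogonality; congr (_ == k).
by apply: eq_card => i; rewrite !inE eq_sym.
Qed.

Lemma orthogonality_irr (k : nat) : (0 < k)%N -> irreflexive (@orthogonality k).
Proof.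
case: k => // k _ x; rewrite /orthogonality.
have -> : [set i | x ord0 i != x ord0 i] = set0.
  by apply/setP => i; rewrite !inE eqxx.
by rewrite cards0.
Qed.

(* Main.v *)
Require Import Defs.
From mathcomp Require Import all_boot all_fingroup all_algebra.

(** A vertex [x] and its complement [x + 1] are twins: exchanging them is an automorphism,
    so a distinguishing labeling separates them.  If there are at most two
    labels, every class then contains exactly one vertex of each pair
    [{x, x + 1}], and a translation, which permutes these pairs, can be
    corrected by complements to an automorphism preserving the classes. *)

Set Implicit Arguments.
Unset Strict Implicit.
Unset Printing Implicit Defensive.

Import GRing.Theory.

Lemma preserves_classesP (T : finType) (d : nat) (f : {ffun T -> 'I_d})
    (p : {perm T}) :
  reflect (forall x, f (p x) = f x) (preserves_classes f p).
Proof.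
apply: (iffP forallP) => [pres x | fp c].
  have: p x \in p @: (f @^-1: [set f x]) by apply: imset_f; rewrite !inE.
  by rewrite (eqP (pres _)) !inE => /eqP.
rewrite eqEcard card_imset ?leqnn ?andbT; last exact: perm_inj.
by apply/subsetP => _ /imsetP[x + ->]; rewrite !inE fp.
Qed.

Lemma distinguishing_id (T : finType) (e : rel T) (d : nat)
    (f : {ffun T -> 'I_d}) (p : {perm T}) :
    distinguishing e f -> (forall x y, e (p x) (p y) = e x y) ->
  (forall x, f (p x) = f x) -> forall x, p x = x.
Proof.
move=> /forallP/(_ p)/implyP distf autp presp x.
suff /distf/eqP->: is_aut e p && preserves_classes f p by rewrite perm1.
apply/andP; split; last exact/preserves_classesP.
by apply/forallP => y; apply/forallP => z; apply/eqP.
Qed.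

Lemma distinguishing_twins (T : finType) (e : rel T) (d : nat)
    (f : {ffun T -> 'I_d}) (x y : T) :
    symmetric e -> distinguishing e f -> e x =1 e y -> x != y -> f x != f y.
Proof.
move=> e_sym distf exy; apply: contraNneq => fxy.
(* The swap leaves the neighbourhood of each vertex unchanged; symmetry of [e] then handles both
   arguments in turn. *)
have twin u : e (tperm x y u) =1 e u by move=> v; case: tpermP => // ->.
have /(_ x) : forall z, tperm x y z = z.
  apply: (distinguishing_id distf) => [u v | u]; last by case: tpermP => // ->.
  by rewrite twin e_sym twin e_sym.
by rewrite tpermL => ->.
Qed.

(** Only one label is left besides [b]. The bound on the number of labels enters the argument
    here. *)
Lemma eq_ord_le2 (d : nat) (a b c : 'I_d) :
  d <= 2 -> a != b -> c != b -> a = c.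
Proof.
case: d a b c => [|[|[|//]]] a b c _; first by case: a.
  by rewrite (ord1 a) (ord1 b).
by case: a => [[|[|//]] ?]; case: b => [[|[|//]] ?]; case: c => [[|[|//]] ?] //= _ _;
  apply: val_inj.
Qed.

Local Open Scope ring_scope.

Lemma addF2_neq (a b : 'F_2) : (a + 1 != b) = (a == b).
Proof. by case: a => [[|[|//]] ?]; case: b => [[|[|//]] ?]. Qed.

Lemma addrr_F2 (n : nat) (x : 'rV['F_2]_n) : x + x = 0.
Proof. by apply/rowP => i; rewrite !mxE addrr_pchar2 ?pchar_Fp. Qed.

Lemma addrK_F2 (n : nat) (y : 'rV['F_2]_n) : involutive (+%R^~ y).
Proof. by move=> x; rewrite -addrA addrr_F2 addr0. Qed.

(** Complementing [x] complements the set of positions where it differs from [y], and among [2 * k]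
    positions a set has size [k] exactly when its complement does. *)
Lemma orthogonality_compl (k : nat) (x : 'rV['F_2]_(2 * k)) :
  orthogonality (x + const_mx 1) =1 orthogonality x.
Proof.
move=> y; rewrite /orthogonality.
set A := [set i | x ord0 i != y ord0 i].
have -> : [set i | (x + const_mx 1) ord0 i != y ord0 i] = ~: A.
  by apply/setP => i; rewrite !inE !mxE addF2_neq negbK.
have cardA : (#|A| + #|~: A| = k + k)%N by rewrite cardsC card_ord mul2n addnn.
apply/eqP/eqP => eqk; move: cardA; rewrite eqk; first exact: addIn.
exact: addnI.
Qed.

Lemma orthogonality_add (k : nat) (z x y : 'rV['F_2]_(2 * k)) :
  orthogonality (x + z) (y + z) = orthogonality x y.
Proof.
congr (_ == k); apply: eq_card => i.
by rewrite !inE !mxE (inj_eq (addIr _)).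
Qed.

Lemma not_distinguishing_le2 (k d : nat) (f : {ffun 'rV['F_2]_(2 * k) -> 'I_d}) :
  (0 < k)%N -> (d <= 2)%N -> ~~ distinguishing (@orthogonality k) f.
Proof.
move=> k_gt0 d_le2; apply/negP => distf.
pose j : 'rV['F_2]_(2 * k) := const_mx 1.
have k2_gt1 : (1 < 2 * k)%N by rewrite mul2n -addnn -(addn1 1) leq_add.
pose i0 := Ordinal (ltnW k2_gt1); pose i1 := Ordinal k2_gt1.
(* The translation vector must avoid [0] and [j]: a unit vector differs from [0] at [i0] and from
   [j] at [i1]. *)
pose u : 'rV['F_2]_(2 * k) := delta_mx ord0 i0.
have u_neq0 : u != 0 by apply/eqP => /rowP/(_ i0); rewrite !mxE !eqxx.
have j_neq0 : j != 0 by apply/eqP => /rowP/(_ i0); rewrite !mxE.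
have uj_neq0 : u + j != 0 by apply/eqP => /rowP/(_ i1); rewrite !mxE.
have f_compl x : f (x + j) != f x.
  apply: distinguishing_twins (@orthogonality_sym k) distf _ _.
    exact: orthogonality_compl.
  by rewrite -subr_eq0 addrC addKr.
pose tau x := if f (x + u) == f x then x + u else x + u + j.
have f_tau x : f (tau x) = f x.
  rewrite /tau; case: eqVneq => // fxu.
  (* The labels of [x] and of [x + u + j] both differ from that of [x + u]. *)
  by apply: eq_ord_le2 (f_compl (x + u)) _; rewrite // eq_sym.
have tauK : involutive tau.
  (* [tau x + u] is [x] or [x + j], and of these only [x] has label [f x], so the second application
     adds [j] exactly when the first did. *)
  move=> x; rewrite {1}/tau f_tau /tau; case: (f (x + u) == f x).
    by rewrite addrK_F2 eqxx.
  by rewrite (addrAC _ j) addrK_F2 (negbTE (f_compl x)) addrK_F2.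
have tau_orth x : orthogonality (tau x) =1 orthogonality (x + u).
  by move=> y; rewrite /tau; case: ifP => // _; rewrite orthogonality_compl.
(* The contradiction comes at [0], which [tau] sends to [u] or [u + j], both nonzero. *)
have /(_ 0) : forall x, perm (inv_inj tauK) x = x.
  apply: (distinguishing_id distf) => [x y | x]; rewrite !permE //.
  rewrite tau_orth orthogonality_sym tau_orth orthogonality_sym.
  exact: orthogonality_add.
by rewrite permE /tau add0r; case: ifP => _; apply/eqP.
Qed.

Local Close Scope ring_scope.

Theorem theorem3 (k : nat) (hk : 1 <= k) : 2 < Dist (@orthogonality k).
Proof.
rewrite /Dist; case: ex_minnP => d /existsP[f distf] _.
by rewrite ltnNge; apply: contraL distf => /(not_distinguishing_le2 f hk).
Qed.
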